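(* Let $d\geq1$ be an integer and $b>0$. As $a,\alpha,\beta,\gamma$ tend to infinity, with $(\alpha,\beta,\gamma)\in\mathcal P_d$, in such a way that $a\sqrt{\frac{\alpha}{\beta\gamma}}$ tends to $b$, the Gauss hypergeometric covariance $G_d(\cdot;a,\alpha,\beta,\gamma)$ converges uniformly on $\mathbb{R}^d$ to the Gaussian covariance with scale factor $b$: $$\boldsymbol h\mapsto\exp\left(-\frac{\|\boldsymbol h\|^2}{b^2}\right),\qquad\boldsymbol h\in\mathbb{R}^d.$$
   Context: $\mathcal P_d$ is the set of triplets $(\alpha,\beta,\gamma)$ of positive reals with $\alpha>\frac d2$, $2(\beta-\alpha)(\gamma-\alpha)\geq\alpha$ and $2(\beta+\gamma)\geq6\alpha+1$ (these imply $\beta>\alpha$, $\gamma>\alpha$). For $a>0$ and $(\alpha,\beta,\gamma)\in\mathcal P_d$, the Gauss hypergeometric covariance is $$G_d(\boldsymbol h;a,\alpha,\beta,\gamma)=\frac{\Gamma(\beta-\frac d2)\Gamma(\gamma-\frac d2)}{\Gamma(\beta-\alpha+\gamma-\frac d2)\Gamma(\alpha-\frac d2)}\left(1-\frac{\|\boldsymbol h\|^2}{a^2}\right)_+^{\beta-\alpha+\gamma-\frac d2-1}{}_2F_1\left(\beta-\alpha,\gamma-\alpha;\beta-\alpha+\gamma-\tfrac d2;\left(1-\tfrac{\|\boldsymbol h\|^2}{a^2}\right)_+\right),\quad\boldsymbol h\in\mathbb{R}^d,$$ where $(x)_+=\max\{x,0\}$ and ${}_2F_1$ is the Gauss hypergeometric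 function. *)

(* Defs.v *)
From HB Require Import structures.
From mathcomp Require Import all_boot all_order all_algebra.
From mathcomp Require Import all_classical all_reals all_analysis.
Set Implicit Arguments. Unset Strict Implicit. Unset Printing Implicit Defensive.
Import Order.TTheory GRing.Theory Num.Theory.
Import numFieldNormedType.Exports.
Local Open Scope classical_set_scope.
Local Open Scope ring_scope.

(* The norm `|h| of the library on 'rV[R]_d is the sup norm. *)
Definition enorm (R : realType) (d : nat) (h : 'rV[R]_d) : R :=
  Num.sqrt (\sum_(i < d) h ord0 i ^+ 2).

(* Euler's integral of the second kind; it equals the Gamma function for x > 0
   only, which covers every argument it receives below. *)
Definition Gamma (R : realType) (x : R) : R :=
  \int[@lebesgue_measure R]_(t in `]0, +oo[) (t `^ (x - 1) * expR (- t)).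

Definition pochhammer (R : realType) (x : R) (n : nat) : R :=
  \prod_(i < n) (x + i%:R).

(* The Gauss series, which converges for `|x| < 1, and also at x = 1 when
   p + q < r. In gauss_hyp_cov below x lies in [0, 1], and
   r - p - q = alpha - d/2 > 0. *)
Definition hyp2F1 (R : realType) (p q r x : R) : R :=
  limn (series (fun n : nat =>
    pochhammer p n * pochhammer q n / pochhammer r n * (x ^+ n / n`!%:R))).

Definition pos_part (R : realType) (x : R) : R := Num.max x 0.

Definition param_set (R : realType) (d : nat) (alpha beta gamma : R) : Prop :=
  [/\ [/\ 0 < alpha, 0 < beta & 0 < gamma],
      d%:R / 2 < alpha,
      alpha <= 2 * (beta - alpha) * (gamma - alpha)
    & 6 * alpha + 1 <= 2 * (beta + gamma)].

(* On param_set with d > 0 the exponent of the power is positive, so that the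
   convention 0 `^ p = 0 for p != 0 makes the function vanish where
   enorm h >= a. *)
Definition gauss_hyp_cov (R : realType) (d : nat) (a alpha beta gamma : R)
    (h : 'rV[R]_d) : R :=
  let u := pos_part (1 - enorm h ^+ 2 / a ^+ 2) in
  Gamma (beta - d%:R / 2) * Gamma (gamma - d%:R / 2)
    / (Gamma (beta - alpha + gamma - d%:R / 2) * Gamma (alpha - d%:R / 2))
  * u `^ (beta - alpha + gamma - d%:R / 2 - 1)
  * hyp2F1 (beta - alpha) (gamma - alpha) (beta - alpha + gamma - d%:R / 2) u.

Definition gaussian_cov (R : realType) (d : nat) (b : R) (h : 'rV[R]_d) : R :=
  expR (- (enorm h ^+ 2 / b ^+ 2)).

(* Main.v *)
Require Import Defs.
From HB Require Import structures.
From mathcomp Require Import all_boot all_order all_algebra.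
From mathcomp Require Import all_classical all_reals all_analysis.
From mathcomp Require Import measurable_realfun ring lra.
Import Order.TTheory GRing.Theory Num.Theory.
Import numFieldNormedType.Exports.
Local Open Scope classical_set_scope.
Local Open Scope ring_scope.

(** Put M = beta - d/2 - 1 and let X be Beta-distributed with parameters
    A = alpha - d/2 and q = gamma - alpha. Euler's integral for 2F1, after the
    substitution x = 1 - u t with u = 1 - |h|^2/a^2, shows that
      G_d(h) = E [ (1 - |h|^2 / (a^2 X))_+ ^ M ].
    One has |(1 - y/M)_+^M - exp(-y)| <= 4/M for y >= 0, and
    |exp(-v) - exp(-w v)| <= 2 |w - 1| <= e + (w - 1)^2 / e for v, w >= 0 and
    e > 0. Taking w = c X with c = a^2 / (b^2 M) bounds the distance to the
    Gaussian, uniformly in h, by 4/M + e + E [(c X - 1)^2] / e. The first two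
    moments of X are explicit, and E [(c X - 1)^2] tends to 0.
    Euler's integral, the binomial series and the Beta-Gamma relation only
    involve integrals of nonnegative functions over the whole line, so that
    Tonelli's theorem and monotone convergence apply without integrability
    conditions. *)

(** * Affine change of variables for Lebesgue measure *)

Section Affine.
Local Open Scope ereal_scope.
Context {R : realType}.
Local Notation mu := (@lebesgue_measure R).

Lemma measurable_affine (c b : R) :
  measurable_fun setT ((fun x : R => c * x + b)%R : R -> measurableTypeR R).
Proof.
by apply: measurable_funD => //;
  exact: measurable_funM.
Qed.

(** Agreement on half-open intervals is all that [lebesgue_measure_unique] asks for. For c < 0 the
    preimage is closed on the left instead, with the same length. *)
Lemma lebesgue_measure_affine_preimage (c b x y : R) : (c != 0)%R ->
  mu `]x, y]%classic =
  `|c|%:E * mu [set t : R | `]x, y]%classic (c * t + b)%R].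
Proof.
move=> c0; rewrite lebesgue_measure_itv/= lte_fin.
have [cn|cp|c0'] := ltgtP c 0%R; last by rewrite c0' eqxx in c0.
- have -> : [set t : R | `]x, y]%classic (c * t + b)%R] =
      `[((y - b) / c)%R, ((x - b) / c)%R[%classic.
    by apply/seteqP; split=> t/=; rewrite !in_itv/= ltr_ndivlMr// ler_ndivrMr//
      ltrBlDr lerBrDr mulrC andbC.
  rewrite lebesgue_measure_itv/= lte_fin ltr_nM2r ?invr_lt0// ltrD2r.
  case: ifPn => _; last by rewrite mule0.
  by rewrite -!EFinB -EFinM ltr0_norm// -mulrBl; congr EFin; field.
- have -> : [set t : R | `]x, y]%classic (c * t + b)%R] =
      `]((x - b) / c)%R, ((y - b) / c)%R]%classic.
    by apply/seteqP; split=> t/=; rewrite !in_itv/= ltr_pdivrMr// ler_pdivlMr//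
      ltrBlDr lerBrDr mulrC.
  rewrite lebesgue_measure_itv/= lte_fin ltr_pM2r ?invr_gt0// ltrD2r.
  case: ifPn => _; last by rewrite mule0.
  by rewrite -!EFinB -EFinM gtr0_norm// -mulrBl; congr EFin; field.
Qed.

(** By uniqueness, Lebesgue measure is |c| times its own pushforward under the affine map. *)
Lemma ge0_integral_affine (c b : R) (f : R -> \bar R) : (c != 0)%R ->
  measurable_fun setT f -> (forall x, 0 <= f x) ->
  \int[mu]_x f x = `|c|%:E * \int[mu]_x f (c * x + b)%R.
Proof.
move=> c0 mf f0.
pose phi : {mfun (measurableTypeR R) >-> measurableTypeR R} :=
  HB.pack (fun x : measurableTypeR R => c * x + b)%R
    (isMeasurableFun.Build _ _ (measurableTypeR R) (measurableTypeR R) _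
      (measurable_affine c b)).
have k0 : (0 <= `|c|)%R by [].
rewrite (eq_measure_integral (mscale (NngNum k0) (pushforward mu phi))).
  rewrite ge0_integral_mscale//=; congr (_ * _).
  by apply: (@ge0_integral_pushforward _ _ (measurableTypeR R)
    (measurableTypeR R) R phi _ mu setT f).
move=> A mA _; apply: lebesgue_measure_unique mA => _ [[x y]] _ <-.
exact: lebesgue_measure_affine_preimage.
Qed.

End Affine.

(** * Euler's Gamma and Beta integrals over the whole line *)

Section EulerIntegrals.
Context {R : realType}.
Local Notation mu := (@lebesgue_measure R).
Implicit Types (s q x y c : R).

(* [x_+^(s-1)]: the exponent is shifted by one, as in Euler's integrals. *)
Definition kpow s x : R := if 0 < x then x `^ (s - 1) else 0.

Lemma kpow_ge0 s x : 0 <= kpow s x.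
Proof. by rewrite /kpow; case: ifP => // _; exact: powR_ge0. Qed.

Lemma measurable_kpow s : measurable_fun setT (kpow s).
Proof.
apply: measurable_fun_ifT.
- exact: (@measurable_fun_ltr _ _ R setT (cst 0) id).
- exact: measurable_powR.
- exact: measurable_cst.
Qed.

Lemma kpow_le0 s x : x <= 0 -> kpow s x = 0.
Proof. by rewrite /kpow leNgt => /negbTE ->. Qed.

Lemma kpowM s c x : 0 < c -> kpow s (c * x) = c `^ (s - 1) * kpow s x.
Proof.
move=> c0; rewrite /kpow pmulr_rgt0//; case: ifPn => [x0|]; last by rewrite mulr0.
by rewrite powRM// ltW.
Qed.

Lemma mulr_kpow s x : 0 < s -> x * kpow s x = kpow (s + 1) x.
Proof.
move=> s0; rewrite /kpow; case: ifPn => [x0|]; last by rewrite mulr0.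
by rewrite -{1}(powRr1 (ltW x0)) -powRD ?(gt_eqF x0) ?implybT//; congr powR; ring.
Qed.

(* Extended-real valued, because finiteness is only known for s > 0, after
   [gammaE_fin_gt0]. *)
Definition gammaE s : \bar R := (\int[mu]_x (kpow s x * expR (- x))%:E)%E.
Definition betaE q s : \bar R := (\int[mu]_x (kpow q x * kpow s (1 - x))%:E)%E.

Lemma measurable_kpow_expR s c :
  measurable_fun setT (fun x : R => kpow s x * expR (- (c * x))).
Proof.
apply: measurable_funM; first exact: measurable_kpow.
apply: measurableT_comp; first exact: measurable_expR.
by apply: measurable_funN; exact: measurable_funM.
Qed.

Lemma measurable_kpow2 q s y :
  measurable_fun setT (fun x : R => kpow q x * kpow s (y - x)).
Proof.
apply: measurable_funM; first exact: measurable_kpow.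
apply: measurableT_comp; first exact: measurable_kpow.
exact: measurable_funB.
Qed.

Lemma gammaE_ge0 s : (0 <= gammaE s)%E.
Proof.
by apply: integral_ge0 => x _; rewrite lee_fin mulr_ge0 ?kpow_ge0 ?expR_ge0.
Qed.

Lemma betaE_ge0 q s : (0 <= betaE q s)%E.
Proof. by apply: integral_ge0 => x _; rewrite lee_fin mulr_ge0 ?kpow_ge0. Qed.

(** The Jacobian c and the factor c^(s-1) of the kernel combine to c^s. The case c = 1 - x yields
    the power in [nneseries_binomial]. *)
Lemma gammaE_scale s c : 0 < c ->
  gammaE s = ((c `^ s)%:E * \int[mu]_x (kpow s x * expR (- (c * x)))%:E)%E.
Proof.
move=> c0; rewrite /gammaE (@ge0_integral_affine _ c 0); last 3 first.
- by rewrite gt_eqF.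
- have := measurable_kpow_expR s 1; under eq_fun do rewrite mul1r.
  by move=> ?; exact/measurable_EFinP.
- by move=> x; rewrite lee_fin mulr_ge0 ?kpow_ge0 ?expR_ge0.
rewrite (gtr0_norm c0).
under eq_integral => x _ do rewrite addr0 kpowM// -mulrA EFinM.
rewrite ge0_integralZl_EFin ?powR_ge0//.
- rewrite muleA -EFinM; congr (_%:E * _)%E.
  rewrite -{1}(powRr1 (ltW c0)) -powRD ?(gt_eqF c0) ?implybT//; congr powR; ring.
- by move=> x _; rewrite lee_fin mulr_ge0 ?kpow_ge0 ?expR_ge0.
- by apply/measurable_EFinP; exact: measurable_kpow_expR.
Qed.

(** Scaling by y reduces the convolution to the unit interval; the two exponents and the Jacobian
    add up to q + s - 1. *)
Lemma integral_kpow_conv q s y : 0 < y ->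
  (\int[mu]_x (kpow q x * kpow s (y - x))%:E =
   (kpow (q + s) y)%:E * betaE q s)%E.
Proof.
move=> y0; rewrite (@ge0_integral_affine _ y 0); last 3 first.
- by rewrite gt_eqF.
- by apply/measurable_EFinP; exact: measurable_kpow2.
- by move=> x; rewrite lee_fin mulr_ge0 ?kpow_ge0.
rewrite (gtr0_norm y0).
under eq_integral => x _.
  rewrite addr0 (_ : y - y * x = y * (1 - x)); last by ring.
  rewrite !kpowM// mulrACA EFinM; over.
rewrite ge0_integralZl_EFin ?mulr_ge0 ?powR_ge0//.
- rewrite muleA -EFinM; congr (_%:E * _)%E.
  rewrite /kpow y0 -{1}(powRr1 (ltW y0)) -!powRD ?(gt_eqF y0) ?implybT//.
  by congr powR; ring.
- by move=> x _; rewrite lee_fin mulr_ge0 ?kpow_ge0.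
- by apply/measurable_EFinP; exact: measurable_kpow2.
Qed.

(* Write Gamma(q) Gamma(s) as a double integral, shift the inner variable
   to x + y, and exchange the integrals. *)
Lemma gammaE_betaE q s : (gammaE q * gammaE s = gammaE (q + s) * betaE q s)%E.
Proof.
have m1 s' : measurable_fun setT (fun x : R => (kpow s' x * expR (- x))%:E).
  have := measurable_kpow_expR s' 1; under eq_fun do rewrite mul1r.
  by move=> ?; exact/measurable_EFinP.
rewrite {1}/gammaE -ge0_integralZr ?gammaE_ge0//; last first.
  by move=> x _; rewrite lee_fin mulr_ge0 ?kpow_ge0 ?expR_ge0.
  exact: m1.
pose F (z : R * R) := (kpow q z.1 * kpow s (z.2 - z.1) * expR (- z.2))%:E.
have F0 z : (0 <= F z)%E by rewrite lee_fin !mulr_ge0 ?kpow_ge0 ?expR_ge0.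
have mF : measurable_fun setT F.
  apply/measurable_EFinP; apply: measurable_funM; last first.
    apply: measurableT_comp; first exact: measurable_expR.
    by apply: measurable_funN; exact: measurable_snd.
  apply: measurable_funM.
    by apply: measurableT_comp; [exact: measurable_kpow|exact: measurable_fst].
  apply: measurableT_comp; first exact: measurable_kpow.
  by apply: measurable_funB; [exact: measurable_snd|exact: measurable_fst].
transitivity (\int[mu]_x \int[mu]_y F (x, y))%E.
  apply: eq_integral => x _; rewrite /gammaE -ge0_integralZl_EFin//; last 3 first.
  - by move=> y _; rewrite lee_fin mulr_ge0 ?kpow_ge0 ?expR_ge0.
  - exact: m1.
  - by rewrite mulr_ge0 ?kpow_ge0 ?expR_ge0.
  rewrite [RHS](@ge0_integral_affine _ 1 x) ?oner_eq0//; last first.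
    exact: (measurableT_comp mF (pair1_measurable x)).
  rewrite normr1 mul1e; apply: eq_integral => y _.
  rewrite -EFinM /F/= (_ : 1 * y + x - x = y); last by ring.
  by rewrite mul1r opprD expRD mulrACA (mulrC (expR (- y))) mulrA.
rewrite fubini_tonelli// [in RHS]/gammaE -ge0_integralZr ?betaE_ge0//; last first.
  by move=> x _; rewrite lee_fin mulr_ge0 ?kpow_ge0 ?expR_ge0.
  exact: m1.
apply: eq_integral => y _; rewrite /F/=.
under eq_integral => x _ do rewrite EFinM.
rewrite ge0_integralZr//; last 2 first.
- by apply/measurable_EFinP; exact: measurable_kpow2.
- by move=> x _; rewrite lee_fin mulr_ge0 ?kpow_ge0.
(* For y <= 0, x and y - x are never both positive, so both sides vanish. *)
have [y0|y0] := ltP 0 y; first by rewrite integral_kpow_conv// EFinM muleAC.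
rewrite (kpow_le0 _ _ y0) mul0r mul0e integral0_eq ?mul0e// => x _.
have [x0|x0] := ltP 0 x; last by rewrite (kpow_le0 _ _ x0) mul0r.
by rewrite (kpow_le0 s (y - x)) ?mulr0//; lra.
Qed.

End EulerIntegrals.

(** * Functional equation, finiteness and positivity of Gamma *)

Section GammaFunction.
Context {R : realType}.
Local Notation mu := (@lebesgue_measure R).
Implicit Types (s q x y c : R).

Lemma gammaEE s :
  gammaE s = (\int[mu]_(t in `]0%R, +oo[) (t `^ (s - 1) * expR (- t))%:E)%E.
Proof.
rewrite [RHS]integral_mkcond; apply: eq_integral => x _.
rewrite patchE mem_setE in_itv/= andbT /kpow.
by case: ifPn => // _; rewrite mul0r.
Qed.

Lemma gammaE1 : gammaE (1 : R) = 1%E.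
Proof.
rewrite gammaEE subrr.
under eq_integral => x _ do rewrite powRr0 mul1r.
rewrite integral_itv_obnd_cbnd; last first.
  apply/measurable_EFinP/measurable_funTS.
  apply: measurableT_comp; first exact: measurable_expR.
  exact: oppr_measurable.
rewrite -[RHS](integral_exponential_pdf (@ltr01 R)) [LHS]integral_mkcond.
apply: eq_integral => x _; rewrite /exponential_pdf !patchE.
by case: ifPn => // _; rewrite mul1r mulN1r.
Qed.

(** Away from 0 the integrand is continuous even for s < 1, so the fundamental theorem of calculus
    applies; [betaE_s1] then lets e tend to 0. *)
Lemma integral_powR_itv s (e : R) : 0 < s -> 0 < e < 1 ->
  (\int[mu]_(x in `[e, 1%R]) (x `^ (s - 1))%:E = (s^-1 * (1 - e `^ s))%:E)%E.
Proof.
move=> s0 /andP[e0 e1].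
have gt0 (x : R) : e <= x -> 0 < x by exact: lt_le_trans.
have dpow r (x : R) : 0 < x -> derivable ((powR (R:=R))^~ r) x 1.
  by move=> x0; apply: derivable_powR; rewrite in_itv/= x0.
pose G (x : R) := s^-1 * x `^ s.
have dG (x : R) : 0 < x -> is_derive x 1 G (x `^ (s - 1)).
  move=> x0; have dp := is_derive1_powR s x0.
  rewrite (_ : x `^ (s - 1) = s^-1 *: (s * x `^ (s - 1))); last first.
    by rewrite /GRing.scale/= mulKf// gt_eqF.
  exact: is_deriveZ.
have cG (x : R) : 0 < x -> {for x, continuous G}.
  move=> x0; apply: differentiable_continuous; apply/derivable1_diffP.
  exact: (@ex_derive _ _ _ _ _ _ _ (dG x x0)).
rewrite (@continuous_FTC2 _ _ G e 1)//.
- by rewrite -EFinB /G powR1; congr EFin; ring.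
- apply: derivable_within_continuous => x; rewrite in_itv/= => /andP[ex _].
  exact/dpow/gt0.
- split=> [x|/=|/=].
  + rewrite in_itv/= => /andP[ex _]; have x0 : 0 < x by apply/gt0/ltW.
    exact: (@ex_derive _ _ _ _ _ _ _ (dG x x0)).
  + by apply: cvg_at_right_filter; apply: cG.
  + by apply: cvg_at_left_filter; apply: cG.
- move=> x; rewrite in_itv/= => /andP[ex _]; have x0 : 0 < x by apply/gt0/ltW.
  by rewrite derive1E; apply: (@derive_val _ _ _ _ _ _ _ (dG x x0)).
Qed.

Lemma betaE_s1 s : 0 < s -> betaE s 1 = (s^-1)%:E.
Proof.
move=> s0.
have mpow (D : set R) : measurable D ->
    measurable_fun D (fun x : R => (x `^ (s - 1))%:E).
  move=> mD; apply/measurable_EFinP; apply: measurable_funTS.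
  exact: measurable_powR.
transitivity (\int[mu]_(x in `]0%R, 1%R]) (x `^ (s - 1))%:E)%E.
  (* The factor [kpow 1 (1 - x)] is the indicator of x < 1, hence the removal of the endpoint 1. *)
  rewrite -integral_itv_bndo_bndc; last exact: mpow.
  rewrite [RHS]integral_mkcond; apply: eq_integral => x _.
  rewrite patchE mem_setE in_itv/= /kpow subr_gt0 subrr powRr0.
  by case: (0 < x); case: (x < 1); rewrite /= ?(mulr0, mulr1, mul0r).
(* Starting at 1/2 keeps [e n] below 1, as [integral_powR_itv] requires. *)
pose e (n : nat) : R := n.+2%:R^-1.
have e0 n : 0 < e n by rewrite invr_gt0 ltr0n.
have e1 n : e n < 1 by rewrite invf_lt1 ?ltr0n// ltr1n.
have ecvg : e n @[n --> \oo] --> (0 : R).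
  rewrite /e (cvg_shiftS (fun n : nat => n.+1%:R^-1 : R)).
  exact: cvg_harmonic.
have -> : `]0%R, 1%R]%classic = \bigcup_n `[e n, 1]%classic :> set R.
  apply/seteqP; split=> x /=.
    rewrite in_itv/= => /andP[x0 x1].
    have /cvgrPdist_lt/(_ _ x0)[n _ /(_ n (leqnn n))/=] := ecvg.
    rewrite sub0r normrN gtr0_norm// => enx.
    by exists n => //=; rewrite in_itv/= x1 ltW.
  move=> [n _ /=]; rewrite !in_itv/= => /andP[ex ->]; rewrite andbT.
  exact: lt_le_trans ex.
have c1 : (\int[mu]_(x in `[e n, 1%R]) (x `^ (s - 1))%:E)%E @[n --> \oo] -->
    (\int[mu]_(x in \bigcup_n `[e n, 1%R]%classic) (x `^ (s - 1))%:E)%E.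
  apply: ge0_nondecreasing_set_cvg_integral => //.
  - move=> m n mn; apply/subsetPset; apply: subset_itvr; rewrite bnd_simp.
    by rewrite lef_pV2 ?posrE// ?ler_nat.
  - by move=> n; exact: mpow.
  - by move=> n x _; rewrite lee_fin powR_ge0.
have c2 : (\int[mu]_(x in `[e n, 1%R]) (x `^ (s - 1))%:E)%E @[n --> \oo] -->
    (s^-1)%:E.
  under eq_fun do rewrite integral_powR_itv ?e0 ?e1//.
  apply: cvg_EFin; first exact: nearW.
  rewrite -[X in _ --> X]mulr1; apply: cvgMr.
  rewrite -[X in _ --> X]subr0; apply: cvgB; first exact: cvg_cst.
  by have /cvg_at_rightP := powR_cvg0 s0; apply.
exact: cvg_unique c1 c2.
Qed.

(** The Beta-Gamma relation with B(s, 1) = 1/s replaces integration by parts, and holds before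
    finiteness is known. *)
Lemma gammaES s : 0 < s -> gammaE (s + 1) = (s%:E * gammaE s)%E.
Proof.
move=> s0; have := gammaE_betaE s 1; rewrite gammaE1 mule1 betaE_s1// => ->.
by rewrite muleCA -EFinM divff ?gt_eqF// mule1.
Qed.

Lemma gammaE_nat n : gammaE (n.+1%:R : R) = (n`!%:R)%:E.
Proof.
elim: n => [|n IH]; first exact: gammaE1.
by rewrite -natr1 gammaES ?ltr0n// IH -EFinM -natrM factS.
Qed.

(* From x^(t-1) <= x^(s-1) + x^s: comparison with the values at integers
   yields finiteness and positivity. *)
Lemma gammaE_interp s t : s <= t <= s + 1 ->
  (gammaE t <= gammaE s + gammaE (s + 1))%E.
Proof.
move=> /andP[st ts].
have m1 s' : measurable_fun setT (fun x : R => (kpow s' x * expR (- x))%:E).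
  have := measurable_kpow_expR s' 1; under eq_fun do rewrite mul1r.
  by move=> ?; exact/measurable_EFinP.
have p0 s' (x : R) : (0 <= (kpow s' x * expR (- x))%:E)%E.
  by rewrite lee_fin mulr_ge0 ?kpow_ge0 ?expR_ge0.
rewrite /gammaE -ge0_integralD//; [|exact: m1|exact: m1].
apply: ge0_le_integral => //.
- exact: m1.
- by apply: emeasurable_funD; exact: m1.
move=> x _; rewrite -EFinD lee_fin -mulrDl ler_wpM2r ?expR_ge0// /kpow.
case: ifPn => [x0|]; last by rewrite addr0.
have [x1|x1] := leP 1 x.
  by rewrite -[leLHS]add0r lerD ?powR_ge0// ler_powR// lerD2r.
rewrite -[leLHS]addr0 lerD ?powR_ge0//.
(* For x < 1, division by x^(s-1) leaves x^(t-s) <= 1. *)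
rewrite -(ler_pM2r (powR_gt0 (1 - s) x0)) -!powRD ?(gt_eqF x0) ?implybT//.
have -> : s - 1 + (1 - s) = 0 by ring.
rewrite powRr0 [leRHS](_ : 1 = 1 `^ (t - 1 + (1 - s))); last by rewrite powR1.
by apply: ge0_ler_powR; rewrite ?nnegrE ?(ltW x0) ?(ltW x1)//; lra.
Qed.

(** Take an integer n + 1 between s and s + 1. Interpolation from s gives n! <= (1 + s) Gamma(s),
    which excludes 0; interpolation from n + 1 gives s Gamma(s) <= n! + (n + 1)!, which excludes
    infinity. *)
Lemma gammaE_fin_gt0 s : 0 < s -> (0 < gammaE s < +oo)%E.
Proof.
move=> s0.
have [n ns sn] : exists2 n : nat, s <= n.+1%:R & n.+1%:R <= s + 1.
  exists (Num.trunc s); first exact/ltW/truncnS_gt.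
  by rewrite -natr1 lerD2r; have /andP[] := truncn_itv (ltW s0).
have h1 : ((n`!%:R)%:E <= gammaE s + s%:E * gammaE s)%E.
  by rewrite -gammaES// -gammaE_nat gammaE_interp// ns sn.
have h2 : (s%:E * gammaE s <= (n`!%:R)%:E + ((n.+1)`!%:R)%:E)%E.
  rewrite -gammaES// -!gammaE_nat -(natr1 n.+1) gammaE_interp// sn/= lerD2r.
  exact: ns.
case: (gammaE s) (gammaE_ge0 s) h1 h2 => [r| |]//.
  rewrite lee_fin => r0; rewrite -EFinM -!EFinD !lee_fin => h1 _.
  rewrite lte_fin ltry andbT lt_neqAle r0 andbT; apply/eqP => r0'.
  by move: h1; rewrite -r0' mulr0 addr0 leNgt ltr0n fact_gt0.
by move=> _ _; rewrite gt0_muley ?lte_fin// -EFinD leye_eq.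
Qed.

End GammaFunction.

(** * The binomial series and Euler's integral for 2F1 *)

Section HypergeometricSeries.
Context {R : realType}.
Local Notation mu := (@lebesgue_measure R).
Implicit Types (s p q b x u : R).

(** The real-valued [Gamma] would read an infinite integral as 0; [gammaE_fin_gt0] rules this
    out. *)
Lemma gammaE_Gamma s : 0 < s -> gammaE s = (Gamma s)%:E.
Proof.
move=> s0; have /andP[g0 gy] := gammaE_fin_gt0 s s0.
by rewrite /Gamma /Rintegral -gammaEE fineK// ge0_fin_numE// ltW.
Qed.

Lemma Gamma_gt0 s : 0 < s -> 0 < Gamma s.
Proof.
by move=> s0; rewrite -lte_fin -gammaE_Gamma//; have /andP[] := gammaE_fin_gt0 s s0.
Qed.

Lemma GammaS s : 0 < s -> Gamma (s + 1) = s * Gamma s.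
Proof.
move=> s0; apply: EFin_inj.
by rewrite EFinM -!gammaE_Gamma ?addr_gt0// gammaES.
Qed.

Lemma pochhammer_gt0 s n : 0 < s -> 0 < pochhammer s n.
Proof. by move=> s0; apply: prodr_gt0 => i _; rewrite ltr_pwDl. Qed.

Lemma Gamma_pochhammer s n : 0 < s -> Gamma (s + n%:R) = pochhammer s n * Gamma s.
Proof.
move=> s0; elim: n => [|n IH]; first by rewrite addr0 /pochhammer big_ord0 mul1r.
rewrite -natr1 addrA GammaS; last by rewrite ltr_pwDl.
rewrite IH /pochhammer big_ord_recr/=.
by rewrite mulrA; congr (_ * _); rewrite mulrC.
Qed.

Lemma betaE_Gamma q s : 0 < q -> 0 < s ->
  betaE q s = (Gamma q * Gamma s / Gamma (q + s))%:E.
Proof.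
move=> q0 s0; have g0 : Gamma (q + s) != 0 by rewrite gt_eqF// Gamma_gt0// addr_gt0.
have := gammaE_betaE q s; rewrite !gammaE_Gamma ?addr_gt0// -EFinM.
case: (betaE q s) (betaE_ge0 q s) => [r _| |]//.
  by rewrite -EFinM => -[->]; rewrite mulrC mulKf.
by rewrite gt0_muley// lte_fin Gamma_gt0// addr_gt0.
Qed.

(** Links the extended-real sums produced by monotone convergence to the real limits that define
    [expR] and [hyp2F1]. *)
Lemma nneseries_EFin (v : nat -> R) : cvgn (series v) ->
  (\sum_(0 <= n <oo) (v n)%:E = (limn (series v))%:E)%E.
Proof.
move=> cv; rewrite -EFin_lim//; congr (lim (_ @ \oo)%classic).
by apply/funext => n; rewrite sumEFin.
Qed.

Lemma nneseries_expR x : (\sum_(0 <= n <oo) (x ^+ n / n`!%:R)%:E = (expR x)%:E)%E.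
Proof. exact: (nneseries_EFin _ (is_cvg_series_exp_coeff x)). Qed.

Lemma exprn_kpow s x n : 0 < s -> x ^+ n * kpow s x = kpow (s + n%:R) x.
Proof.
move=> s0; elim: n => [|n IH]; first by rewrite expr0 mul1r addr0.
by rewrite exprS -mulrA IH mulr_kpow ?ltr_pwDl// -natr1 addrA.
Qed.

(* Expand exp(x t) inside Gamma(p) = (1-x)^p \int t^(p-1) exp(-t) exp(x t) dt
   and integrate termwise. *)
Lemma nneseries_binomial p x : 0 < p -> 0 <= x < 1 ->
  (\sum_(0 <= n <oo) (pochhammer p n * (x ^+ n / n`!%:R))%:E =
   ((1 - x) `^ (- p))%:E)%E.
Proof.
move=> p0 /andP[x0 x1]; have c0 : 0 < 1 - x by rewrite subr_gt0.
have coef0 n : 0 <= x ^+ n / n`!%:R by rewrite divr_ge0 ?exprn_ge0.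
have G0 := Gamma_gt0 p p0.
pose f n (t : R) := ((x ^+ n / n`!%:R)%:E * (kpow (p + n%:R) t * expR (- (1 * t)))%:E)%E.
have E : (\int[mu]_t (kpow p t * expR (- ((1 - x) * t)))%:E =
    (Gamma p)%:E * \sum_(0 <= n <oo) (pochhammer p n * (x ^+ n / n`!%:R))%:E)%E.
  transitivity (\int[mu]_t (\sum_(0 <= n <oo) f n t)%E)%E.
    apply: eq_integral => t _.
    transitivity ((kpow p t * expR (- (1 * t)))%:E *
        \sum_(0 <= n <oo) ((x * t) ^+ n / n`!%:R)%:E)%E.
      rewrite nneseries_expR -EFinM -mulrA -expRD; congr (_ * expR _)%:E; ring.
    have [t0|t0] := leP t 0.
      rewrite kpow_le0// mul0r mul0e eseries0// => n _ _.
      by rewrite /f kpow_le0// mul0r mule0.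
    rewrite -nneseriesZl; last first.
      by move=> n _; rewrite lee_fin divr_ge0// exprn_ge0// mulr_ge0// ltW.
    apply: eq_eseriesr => n _; rewrite /f -!EFinM -exprn_kpow// exprMn.
    by congr EFin; ring.
  rewrite integral_nneseries//; last 2 first.
  - move=> n; apply: measurable_funeM; apply/measurable_EFinP.
    exact: measurable_kpow_expR.
  - move=> n t _; rewrite mule_ge0// ?lee_fin//.
    by rewrite mulr_ge0 ?kpow_ge0 ?expR_ge0.
  rewrite -nneseriesZl; last first.
    by move=> n _; rewrite lee_fin mulr_ge0 ?coef0// ltW ?pochhammer_gt0.
  apply: eq_eseriesr => n _; rewrite ge0_integralZl_EFin//; last 2 first.
  - by move=> t _; rewrite lee_fin mulr_ge0 ?kpow_ge0 ?expR_ge0.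
  - by apply/measurable_EFinP; exact: measurable_kpow_expR.
  under eq_integral => t _ do rewrite mul1r.
  rewrite -/(gammaE (p + n%:R)) gammaE_Gamma ?ltr_pwDl// Gamma_pochhammer//.
  by rewrite -!EFinM; congr EFin; ring.
(* With S the series, Gamma(p) = (1-x)^p Gamma(p) S; as Gamma(p) is finite and positive, S is finite
   and can be solved for. *)
have := gammaE_scale p _ c0; rewrite E gammaE_Gamma// muleA -EFinM.
case: (\sum_(0 <= n <oo) _)%E => [r| |]//.
- rewrite -EFinM => -[h]; congr EFin; rewrite powRN.
  have cp0 : (1 - x) `^ p != 0 by rewrite gt_eqF// powR_gt0.
  apply: (mulfI cp0); rewrite divff//; apply: (mulIf (lt0r_neq0 G0)).
  by rewrite mul1r [RHS]h; ring.
- by rewrite gt0_muley// lte_fin mulr_gt0// powR_gt0.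
- by rewrite gt0_muleNy// lte_fin mulr_gt0// powR_gt0.
Qed.

Definition hyp_term p q r u n : R :=
  pochhammer p n * pochhammer q n / pochhammer r n * (u ^+ n / n`!%:R).

Lemma hyp_term_ge0 p q r u n : 0 < p -> 0 < q -> 0 < r -> 0 <= u ->
  0 <= hyp_term p q r u n.
Proof.
move=> p0 q0 r0 u0; apply: mulr_ge0; last by rewrite divr_ge0 ?exprn_ge0.
by apply/ltW; rewrite divr_gt0 ?mulr_gt0 ?pochhammer_gt0.
Qed.

(** After the substitution x = 1 - u t, expand (1 - u t)^(-p) in its binomial series. The n-th term
    is a multiple of B(q + n, b), and [Gamma_pochhammer] extracts the Pochhammer symbols.
    Convergence of the sum is settled in [beta_mixture_2F1]. *)
Lemma euler_integral_2F1 p q b u : 0 < p -> 0 < q -> 0 < b -> 0 < u <= 1 ->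
  (\int[mu]_x (x `^ (- p) * (kpow q (1 - x) * kpow b (x - (1 - u))))%:E =
   (u `^ (q + b - 1) * (Gamma q * Gamma b / Gamma (q + b)))%:E *
   \sum_(0 <= n <oo) (hyp_term p q (q + b) u n)%:E)%E.
Proof.
move=> p0 q0 b0 /andP[u0 u1].
have mf : measurable_fun setT
    (fun x : R => x `^ (- p) * (kpow q (1 - x) * kpow b (x - (1 - u)))).
  apply: measurable_funM; first exact: measurable_powR.
  apply: measurable_funM; (apply: measurableT_comp; first exact: measurable_kpow).
    exact: measurable_funB.
  exact: measurable_funB.
have c0 n : 0 <= pochhammer p n * (u ^+ n / n`!%:R).
  by rewrite mulr_ge0 ?divr_ge0 ?exprn_ge0 ?ltW// pochhammer_gt0.
rewrite (@ge0_integral_affine _ (- u) 1); last 3 first.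
- by rewrite oppr_eq0 gt_eqF.
- exact/measurable_EFinP.
- by move=> x; rewrite lee_fin !mulr_ge0 ?powR_ge0 ?kpow_ge0.
rewrite normrN (gtr0_norm u0).
pose f n t : \bar R :=
  ((pochhammer p n * (u ^+ n / n`!%:R))%:E * (kpow (q + n%:R) t * kpow b (1 - t))%:E)%E.
transitivity (u%:E * \int[mu]_t ((u `^ (q - 1) * u `^ (b - 1))%:E *
    \sum_(0 <= n <oo) f n t))%E.
  congr (_ * _)%E; apply: eq_integral => t _.
  have -> : 1 - (- u * t + 1) = u * t by ring.
  have -> : - u * t + 1 - (1 - u) = u * (1 - t) by ring.
  have -> : - u * t + 1 = 1 - u * t by ring.
  rewrite !kpowM//.
  have [t0|t0] := leP t 0.
    rewrite (kpow_le0 _ _ t0) mulr0 mul0r mulr0 eseries0 ?mule0// => n _ _.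
    by rewrite /f kpow_le0// mul0r mule0.
  have [t1|t1] := leP 1 t.
    rewrite (kpow_le0 _ (1 - t)) ?subr_le0// !mulr0 eseries0 ?mule0// => n _ _.
    by rewrite /f (kpow_le0 _ (1 - t)) ?subr_le0// mulr0 mule0.
  (* Strictness comes from t < 1, so u = 1 is covered. *)
  have ut : 0 <= u * t < 1.
    by rewrite mulr_ge0 ?(ltW u0) ?(ltW t0)//= (le_lt_trans _ t1)// ler_piMl// ltW.
  transitivity ((u `^ (q - 1) * u `^ (b - 1))%:E * ((kpow q t * kpow b (1 - t))%:E *
      \sum_(0 <= n <oo) (pochhammer p n * ((u * t) ^+ n / n`!%:R))%:E))%E.
    by rewrite nneseries_binomial// -!EFinM; congr EFin; ring.
  congr (_ * _)%E; rewrite -nneseriesZl; last first.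
    move=> n _; rewrite lee_fin mulr_ge0 ?divr_ge0 ?exprn_ge0//; last by case/andP: ut.
    by rewrite ltW// pochhammer_gt0.
  apply: eq_eseriesr => n _; rewrite /f -!EFinM -exprn_kpow// exprMn.
  by congr EFin; ring.
have mk n : measurable_fun setT (f n).
  by apply: measurable_funeM; apply/measurable_EFinP; exact: measurable_kpow2.
have f0 n t : (0 <= f n t)%E.
  by rewrite mule_ge0 ?lee_fin// mulr_ge0 ?kpow_ge0.
rewrite ge0_integralZl_EFin ?mulr_ge0 ?powR_ge0//; last 2 first.
- by move=> t _; apply: nneseries_ge0 => n _ _; exact: f0.
- by apply: (@ge0_emeasurable_sum _ _ _ _ f predT) => *; [exact: f0|exact: mk].
rewrite integral_nneseries// muleA -EFinM.
rewrite [X in X%:E](_ : _ = u `^ (q + b - 1)); last first.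
  rewrite -{1}(powRr1 (ltW u0)) -!powRD ?(gt_eqF u0) ?implybT//.
  by congr powR; ring.
rewrite EFinM -muleA; congr (_ * _)%E.
have r0 : 0 < q + b by rewrite addr_gt0.
rewrite -nneseriesZl; last first.
  by move=> n _; rewrite lee_fin hyp_term_ge0// ltW.
apply: eq_eseriesr => n _; rewrite ge0_integralZl_EFin//; last 2 first.
- by move=> t _; rewrite lee_fin mulr_ge0 ?kpow_ge0.
- by apply/measurable_EFinP; exact: measurable_kpow2.
have q0' : 0 < q + n%:R by rewrite ltr_pwDl.
rewrite -/(betaE (q + n%:R) b) betaE_Gamma// addrAC !Gamma_pochhammer//.
rewrite -!EFinM /hyp_term; congr EFin.
have : Gamma (q + b) != 0 by rewrite gt_eqF// Gamma_gt0.
have : pochhammer (q + b) n != 0 by rewrite gt_eqF// pochhammer_gt0.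
have : n`!%:R != 0 :> R by rewrite pnatr_eq0 -lt0n fact_gt0.
move: (Gamma q) (Gamma b) (Gamma (q + b)) (pochhammer p n) (pochhammer q n)
  (pochhammer (q + b) n) => Gq Gb G Pp Pq Pr n0 P0 G0.
by field; apply/and3P.
Qed.

End HypergeometricSeries.

(** * The covariance as a Beta mixture of truncated powers *)

Section BetaMixture.
Context {R : realType}.
Local Notation mu := (@lebesgue_measure R).
Implicit Types (s p q b x u z A : R).

Definition beta_kernel A q x : R := kpow A x * kpow q (1 - x).

Definition askey b z : R := pos_part (1 - z) `^ b.

Lemma askey_ge0 b z : 0 <= askey b z. Proof. exact: powR_ge0. Qed.

Lemma askey_le1 b z : 0 <= b -> 0 <= z -> askey b z <= 1.
Proof.
move=> b0 z0; rewrite /askey [leRHS](_ : 1 = 1 `^ b); last by rewrite powR1.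
rewrite ge0_ler_powR ?nnegrE//; first by rewrite /pos_part le_max lexx orbT.
by rewrite /pos_part ge_max ler01 andbT lerBlDr lerDl.
Qed.

Lemma measurable_askey_mixture A q b z :
  measurable_fun setT (fun x : R => beta_kernel A q x * askey b (z / x)).
Proof.
(* Division by x becomes a power of x, which is known to be measurable; the kernel vanishes where
   the two could differ. *)
have -> : (fun x : R => beta_kernel A q x * askey b (z / x)) =
    (fun x : R => beta_kernel A q x * askey b (z * x `^ (-1))).
  apply/funext => x; have [x0|x0] := leP x 0.
    by rewrite /beta_kernel kpow_le0// !mul0r.
  by rewrite powR_inv1// ltW.
apply: measurable_funM; first exact: measurable_kpow2.
have -> : (fun x : R => askey b (z * x `^ (-1))) =
    (powR (R:=R))^~ b \o ((fun x : R => 1 - z * x `^ (-1)) \max cst 0) by [].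
apply: measurableT_comp; first exact: measurable_powR.
apply: measurable_maxr => //; apply: measurable_funB => //.
by apply: measurable_funM => //; exact: measurable_powR.
Qed.

Lemma beta_kernel_ge0 A q x : 0 <= beta_kernel A q x.
Proof. by rewrite mulr_ge0 ?kpow_ge0. Qed.

(** Clearing the denominator of (1 - z/x)^(b-1) releases x^(1-b), which merges with x^(A-1): this is
    Euler's integrand with p = b - A and u = 1 - z. *)
Lemma askey_mixtureE A q b z x : 1 < b -> 0 <= z < 1 ->
  beta_kernel A q x * askey (b - 1) (z / x) =
  x `^ (- (b - A)) * (kpow q (1 - x) * kpow b (x - z)).
Proof.
move=> b1 /andP[z0 z1]; rewrite /beta_kernel /askey /pos_part.
have [x0|x0] := leP x 0.
  by rewrite (kpow_le0 A)// (kpow_le0 b) ?mul0r ?mulr0//; lra.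
have [xz|xz] := leP x z.
  rewrite (kpow_le0 b) ?subr_le0// !mulr0 max_r; last first.
    by rewrite subr_le0 ler_pdivlMr// mul1r.
  (* Here b > 1 matters, since 0 to the power 0 is 1. *)
  by rewrite powR0 ?mulr0// gt_eqF// subr_gt0.
rewrite max_l; last by rewrite subr_ge0 ler_pdivrMr// mul1r ltW.
have -> : 1 - z / x = (x - z) * x^-1 by field; rewrite gt_eqF.
rewrite powRM ?subr_ge0 ?ltW// ?invr_gt0// -powR_inv1 ?(ltW x0)// -powRrM.
rewrite /kpow x0 (subr_gt0 z x) xz.
transitivity (x `^ (A - 1) * x `^ (-1 * (b - 1)) * ((x - z) `^ (b - 1) *
  (if 0 < 1 - x then (1 - x) `^ (q - 1) else 0))); first by ring.
rewrite -powRD ?(gt_eqF x0) ?implybT//.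
have -> : A - 1 + -1 * (b - 1) = - (b - A) by ring.
ring.
Qed.

(** For z >= 1 both sides vanish. For z < 1, [askey] is at most 1 where the kernel is nonzero, so
    the integral is bounded by a Beta integral; its finiteness forces the hypergeometric series to
    converge, also at argument 1. *)
Lemma beta_mixture_2F1 A q b z : 0 < A < b -> 0 < q -> 1 < b -> 0 <= z ->
  (\int[mu]_x (beta_kernel A q x * askey (b - 1) (z / x))%:E =
   (Gamma q * Gamma b / Gamma (q + b) * pos_part (1 - z) `^ (q + b - 1) *
    hyp2F1 (b - A) q (q + b) (pos_part (1 - z)))%:E)%E.
Proof.
move=> /andP[A0 Ab] q0 b1 z0.
have b0 : 0 < b by rewrite (lt_trans _ b1).
have [z1|z1] := leP 1 z.
  rewrite /pos_part max_r ?subr_le0// powR0 ?mulr0 ?mul0r; last first.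
    by rewrite gt_eqF//; lra.
  apply: integral0_eq => x _; rewrite /beta_kernel /askey /pos_part.
  have [x0|x0] := leP x 0; first by rewrite kpow_le0// !mul0r.
  have [x1|x1] := leP 1 x; first by rewrite (kpow_le0 q) ?mulr0 ?mul0r// subr_le0.
  rewrite max_r ?powR0 ?mulr0// ?gt_eqF ?subr_gt0//.
  by rewrite subr_le0 ler_pdivlMr// mul1r (le_trans (ltW x1)).
have u01 : 0 < 1 - z <= 1 by lra.
have fin : (\int[mu]_x (beta_kernel A q x * askey (b - 1) (z / x))%:E < +oo)%E.
  apply: (@le_lt_trans _ _ (betaE A q)); last by rewrite betaE_Gamma// ltry.
  apply: ge0_le_integral => //.
  - by move=> x _; rewrite lee_fin mulr_ge0 ?beta_kernel_ge0 ?askey_ge0.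
  - by apply/measurable_EFinP; exact: measurable_askey_mixture.
  - by apply/measurable_EFinP; exact: measurable_kpow2.
  move=> x _; rewrite lee_fin -/(beta_kernel A q x).
  have [x0|x0] := leP x 0; first by rewrite /beta_kernel kpow_le0// !mul0r.
  by rewrite ler_piMr ?beta_kernel_ge0// askey_le1 ?divr_ge0 ?(ltW x0)//; lra.
have eulerE : (\int[mu]_x (beta_kernel A q x * askey (b - 1) (z / x))%:E =
   ((1 - z) `^ (q + b - 1) * (Gamma q * Gamma b / Gamma (q + b)))%:E *
   \sum_(0 <= n <oo) (hyp_term (b - A) q (q + b) (1 - z) n)%:E)%E.
  rewrite -euler_integral_2F1//; last by rewrite subr_gt0.
  apply: eq_integral => x _; congr EFin.
  rewrite askey_mixtureE// ?z0//.
  by have -> : x - (1 - (1 - z)) = x - z by ring.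
have C0 : 0 < (1 - z) `^ (q + b - 1) * (Gamma q * Gamma b / Gamma (q + b)).
  apply: mulr_gt0; first by rewrite powR_gt0 ?subr_gt0.
  by rewrite divr_gt0 ?mulr_gt0 ?Gamma_gt0 ?addr_gt0.
have t0 n : 0 <= hyp_term (b - A) q (q + b) (1 - z) n.
  by rewrite hyp_term_ge0 ?subr_gt0 ?addr_gt0 ?subr_ge0 ?(ltW z1).
have cv : cvgn (series (hyp_term (b - A) q (q + b) (1 - z))).
  apply: nnseries_is_cvg => //; rewrite ltey; apply/eqP => Sy.
  by move: fin; rewrite eulerE Sy gt0_muley ?lte_fin.
rewrite eulerE nneseries_EFin// -EFinM /pos_part max_l ?subr_ge0 ?(ltW z1)//.
by congr EFin; rewrite (mulrC ((1 - z) `^ _)).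
Qed.

Lemma beta_kernel_integral A q : 0 < A -> 0 < q ->
  (\int[mu]_x (beta_kernel A q x)%:E)%E = (Gamma A * Gamma q / Gamma (A + q))%:E.
Proof. exact: betaE_Gamma. Qed.

(** The normalising mass stands as a factor on the right, which avoids dividing extended reals. *)
Lemma gauss_hyp_cov_mixture d (a alpha beta gamma : R) (h : 'rV[R]_d) :
  d%:R / 2 < alpha -> alpha < beta -> alpha < gamma -> 1 < beta - d%:R / 2 ->
  (\int[mu]_x (beta_kernel (alpha - d%:R / 2) (gamma - alpha) x *
     askey (beta - d%:R / 2 - 1) (enorm h ^+ 2 / a ^+ 2 / x))%:E =
   (gauss_hyp_cov a alpha beta gamma h)%:E *
   \int[mu]_x (beta_kernel (alpha - d%:R / 2) (gamma - alpha) x)%:E)%E.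
Proof.
move=> da ab ag b1; have A0 : 0 < alpha - d%:R / 2 by rewrite subr_gt0.
have q0 : 0 < gamma - alpha by rewrite subr_gt0.
rewrite beta_mixture_2F1//; last 2 first.
- by rewrite A0 ltrD2r.
- by rewrite divr_ge0 ?sqr_ge0.
rewrite beta_kernel_integral// -EFinM /gauss_hyp_cov.
have -> : beta - alpha + gamma - d%:R / 2 = gamma - alpha + (beta - d%:R / 2) by ring.
have -> : beta - d%:R / 2 - (alpha - d%:R / 2) = beta - alpha by ring.
have -> : alpha - d%:R / 2 + (gamma - alpha) = gamma - d%:R / 2 by ring.
have gA := Gamma_gt0 _ A0; have gq := Gamma_gt0 _ q0.
have gg : 0 < Gamma (gamma - d%:R / 2).
  by apply: Gamma_gt0; rewrite subr_gt0 (lt_trans da).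
have gr : 0 < Gamma (gamma - alpha + (beta - d%:R / 2)).
  by apply: Gamma_gt0; rewrite addr_gt0// (lt_trans _ b1).
congr EFin.
move: (Gamma (alpha - d%:R / 2)) (Gamma (gamma - alpha))
  (Gamma (gamma - d%:R / 2)) (Gamma (gamma - alpha + (beta - d%:R / 2)))
  gA gq gg gr => GA Gq Gg Gr gA gq gg gr.
move: (Gamma _) (hyp2F1 _ _ _ _) => Gb H.
by field; rewrite !gt_eqF.
Qed.

End BetaMixture.

(** * Distances between truncated powers and exponentials *)

Section PointwiseBounds.
Context {R : realType}.
Implicit Types (M v w x y e : R).

Lemma expRN_mul_le1 y : 0 <= y -> y * expR (- y) <= 1.
Proof.
move=> y0; rewrite expRN ler_pdivrMr ?expR_gt0// mul1r.
by apply: le_trans (expR_ge1Dx y); rewrite lerDr.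
Qed.

Lemma expRN_sqr_le2 y : 0 <= y -> y ^+ 2 * expR (- y) <= 2.
Proof.
move=> y0; rewrite expRN ler_pdivrMr ?expR_gt0//.
have := expR_ge1Dxn 1 y0; rewrite (_ : 2`! = 2)%N //; lra.
Qed.

(** Factor out the larger exponential and use 1 - exp(-x) <= x. The factor 2 serves w < 1: for w >
    1/2 it bounds 1/w in v exp(-w v) <= 1/w, and for w <= 1/2 the distance is at most 1 <= 2 (1 -
    w). *)
Lemma expRN_dist w v : 0 <= w -> 0 <= v ->
  `|expR (- v) - expR (- (w * v))| <= 2 * `|w - 1|.
Proof.
move=> w0 v0; have ev := expR_gt0 (- v); have ewv := expR_gt0 (- (w * v)).
have yv := expRN_mul_le1 _ v0.
have [w1|w1] := leP 1 w.
  have h := expR_ge1Dx (- ((w - 1) * v)).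
  have E : expR (- (w * v)) = expR (- v) * expR (- ((w - 1) * v)).
    by rewrite -expRD; congr expR; ring.
  rewrite (ger0_norm (_ : 0 <= w - 1)) ?subr_ge0// ger0_norm; last first.
    by rewrite subr_ge0 ler_expR lerN2 ler_peMl.
  rewrite E; nra.
have h := expR_ge1Dx (- ((1 - w) * v)).
have E : expR (- v) = expR (- (w * v)) * expR (- ((1 - w) * v)).
  by rewrite -expRD; congr expR; ring.
have wv0 : 0 <= w * v by rewrite mulr_ge0.
have e1 : expR (- (w * v)) <= 1 by rewrite expR_le1 oppr_le0.
rewrite (ltr0_norm (_ : w - 1 < 0)) ?subr_lt0// ler0_norm; last first.
  by rewrite subr_le0 ler_expR lerN2 ler_piMl// ltW.
have [w2|w2] := leP w 2^-1; first by lra.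
have ywv := expRN_mul_le1 _ wv0.
have : v * expR (- (w * v)) <= 2 by nra.
rewrite E; nra.
Qed.

(** With v = y / M, raise exp(-v - 2 v^2) <= 1 - v <= exp(-v) to the power M, the left inequality
    being valid for v <= 1/2. The gap is then at most 2 y^2 exp(-y) / M <= 4 / M. *)
Lemma askey_expR_dist M y : 0 < M -> 0 <= y ->
  `|askey M (y / M) - expR (- y)| <= 4 / M.
Proof.
move=> M0 y0; set v := y / M; have v0 : 0 <= v by rewrite divr_ge0// ltW.
have yE : y = v * M by rewrite /v divfK// gt_eqF.
clearbody v.
have ey := expR_gt0 (- y).
have pos0 : 0 <= pos_part (1 - v) by rewrite /pos_part le_max lexx orbT.
have up : askey M v <= expR (- y).
  rewrite /askey yE -mulNr expRM ge0_ler_powR ?nnegrE ?expR_ge0 ?(ltW M0)//.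
  by rewrite /pos_part ge_max expR_ge0 andbT expR_ge1Dx.
rewrite ler0_norm ?subr_le0// opprB ler_pdivlMr//.
have := askey_ge0 M v; have [v2|v2] := leP v 2^-1; last first.
  (* For v > 1/2, M < 2 y, so M exp(-y) <= 2 y exp(-y) <= 2. *)
  move=> t0; have := expRN_mul_le1 _ y0; nra.
move=> _; have lo : expR (- y) * expR (- (2 * (y * v))) <= askey M v.
  have -> : expR (- y) * expR (- (2 * (y * v))) = expR (- (v + 2 * v ^+ 2)) `^ M.
    by rewrite -expRM -expRD; congr expR; rewrite yE; ring.
  rewrite /askey ge0_ler_powR ?nnegrE ?expR_ge0 ?(ltW M0)//.
  rewrite /pos_part le_max expRN -[X in X || _]subr_ge0.
  have h := expR_ge1Dx (v + 2 * v ^+ 2).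
  rewrite subr_ge0; apply/orP; left.
  (* Indeed (1 - v) (1 + v + 2 v^2) = 1 + v^2 (1 - 2 v) >= 1. *)
  rewrite -div1r ler_pdivrMr ?expR_gt0//; nra.
have := expR_ge1Dx (- (2 * (y * v))); have := expRN_sqr_le2 _ y0.
have -> : y ^+ 2 = y * v * M by rewrite expr2 {2}yE mulrA.
move=> h2 h1; have h3 : expR (- y) - askey M v <= expR (- y) * (2 * (y * v)).
  by nra.
apply: le_trans (ler_wpM2r (ltW M0) h3) _; nra.
Qed.

(** Triangle inequality through exp(-y). The term 2 |w - 1| is traded for a quadratic one, whose
    Beta expectation only involves two moments. *)
Lemma askey_scale_dist M w y e : 0 < M -> 0 < e -> 0 <= w -> 0 <= y ->
  `|askey M (y / M) - expR (- (w * y))| <= 4 / M + e + (w - 1) ^+ 2 / e.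
Proof.
move=> M0 e0 w0 y0.
apply: le_trans (ler_distD (expR (- y)) _ _) _.
rewrite -addrA lerD ?askey_expR_dist//.
apply: le_trans (expRN_dist w y w0 y0) _.
rewrite -(ler_pM2r e0) [leRHS]mulrDl divfK ?gt_eqF//.
have <- : `|w - 1| ^+ 2 = (w - 1) ^+ 2 by rewrite real_normK ?num_real.
have := sqr_ge0 (e - `|w - 1|); nra.
Qed.

End PointwiseBounds.

(** * Beta moments and the bound uniform in h *)

Section GaussianEstimate.
Context {R : realType}.
Local Notation mu := (@lebesgue_measure R).
Implicit Types (s p q b x u z A c e : R).

Lemma ge0_integral_lincomb (f g : R -> R) (a c If Ig : R) : 0 <= a -> 0 <= c ->
  measurable_fun setT f -> measurable_fun setT g ->
  (forall x, 0 <= f x) -> (forall x, 0 <= g x) ->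
  (\int[mu]_x (f x)%:E = If%:E)%E -> (\int[mu]_x (g x)%:E = Ig%:E)%E ->
  (\int[mu]_x (a * f x + c * g x)%:E = (a * If + c * Ig)%:E)%E.
Proof.
move=> a0 c0 mf mg f0 g0 fI gI.
under eq_integral => x _ do rewrite EFinD !EFinM.
have mf' : measurable_fun setT (EFin \o f) by exact/measurable_EFinP.
have mg' : measurable_fun setT (EFin \o g) by exact/measurable_EFinP.
rewrite ge0_integralD//.
- rewrite !ge0_integralZl_EFin// ?fI ?gI -?EFinM -?EFinD// => x _.
    by rewrite lee_fin.
  by rewrite lee_fin.
- by move=> x _; rewrite mule_ge0 ?lee_fin.
- exact: measurable_funeM.
- by move=> x _; rewrite mule_ge0 ?lee_fin.
- exact: measurable_funeM.
Qed.

Definition beta_mean A q : R := A / (A + q).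

Lemma beta_kernelS A q x : 0 < A ->
  x * beta_kernel A q x = beta_kernel (A + 1) q x.
Proof. by move=> A0; rewrite /beta_kernel mulrA mulr_kpow. Qed.

(** By [beta_kernelS] this is the first moment; applied again at A + 1 it gives the second. *)
Lemma beta_kernel_integralS A q : 0 < A -> 0 < q ->
  (\int[mu]_x (beta_kernel (A + 1) q x)%:E =
   (beta_mean A q)%:E * \int[mu]_x (beta_kernel A q x)%:E)%E.
Proof.
move=> A0 q0; rewrite !beta_kernel_integral ?addr_gt0// -EFinM; congr EFin.
rewrite addrAC !GammaS ?addr_gt0// /beta_mean.
move: (Gamma _) (Gamma _) (Gamma _) (Gamma_gt0 _ (addr_gt0 A0 q0)) => GA Gq G G0.
by field; rewrite !gt_eqF// addr_gt0.
Qed.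

(** Integrate [askey_scale_dist] with w = c x against the kernel. As [m1] and [m2] are the first two
    moments, the last numerator is E [(c X - 1)^2]. *)
Lemma gauss_hyp_cov_estimate d (a b alpha beta gamma e A q M c m1 m2 : R)
    (h : 'rV[R]_d) :
  d%:R / 2 < alpha -> alpha < beta -> alpha < gamma -> 1 < beta - d%:R / 2 ->
  0 < a -> 0 < b -> 0 < e ->
  A = alpha - d%:R / 2 -> q = gamma - alpha -> M = beta - d%:R / 2 - 1 ->
  c = a ^+ 2 / (b ^+ 2 * M) ->
  m1 = beta_mean A q -> m2 = beta_mean (A + 1) q * m1 ->
  `|gauss_hyp_cov a alpha beta gamma h - gaussian_cov b h| <=
  4 / M + e + (c ^+ 2 * m2 - 2 * c * m1 + 1) / e.
Proof.
move=> da ab ag b1 a0 b0 e0 AE qE ME cE m1E m2E.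
have A0 : 0 < A by rewrite AE subr_gt0.
have q0 : 0 < q by rewrite qE subr_gt0.
have M0 : 0 < M by rewrite ME subr_gt0.
have c0 : 0 < c by rewrite cE divr_gt0 ?mulr_gt0 ?exprn_gt0.
pose z := enorm h ^+ 2 / a ^+ 2; have z0 : 0 <= z by rewrite divr_ge0 ?sqr_ge0.
set G := gauss_hyp_cov _ _ _ _ _; set g := gaussian_cov b h.
have g0 : 0 <= g by exact: expR_ge0.
pose phi x := askey M (z / x).
have phi0 x : 0 <= phi x by exact: askey_ge0.
pose w0 := beta_kernel A q; pose w1 := beta_kernel (A + 1) q.
pose w2 := beta_kernel (A + 1 + 1) q.
have w0_ge0 x : 0 <= w0 x by exact: beta_kernel_ge0.
have w1_ge0 x : 0 <= w1 x by exact: beta_kernel_ge0.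
have w2_ge0 x : 0 <= w2 x by exact: beta_kernel_ge0.
have mw0 : measurable_fun setT w0 by exact: measurable_kpow2.
have mw1 : measurable_fun setT w1 by exact: measurable_kpow2.
have mw2 : measurable_fun setT w2 by exact: measurable_kpow2.
have mphi : measurable_fun setT (fun x => w0 x * phi x).
  exact: measurable_askey_mixture.
pose B := Gamma A * Gamma q / Gamma (A + q).
have B0 : 0 < B by rewrite divr_gt0 ?mulr_gt0 ?Gamma_gt0// addr_gt0.
have I0 : (\int[mu]_x (w0 x)%:E = B%:E)%E by exact: beta_kernel_integral.
have I1 : (\int[mu]_x (w1 x)%:E = (m1 * B)%:E)%E.
  by rewrite beta_kernel_integralS// I0 m1E EFinM.
have I2 : (\int[mu]_x (w2 x)%:E = (m2 * B)%:E)%E.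
  by rewrite beta_kernel_integralS ?addr_gt0// I1 -EFinM mulrA -m2E.
have Iphi : (\int[mu]_x (w0 x * phi x)%:E = (G * B)%:E)%E.
  by rewrite EFinM -I0 /phi /w0 /z AE qE ME gauss_hyp_cov_mixture.
pose K := 4 / M + e; have K0 : 0 <= K by rewrite addr_ge0 ?divr_ge0 ?ltW.
have V x : 0 < x -> `|phi x - g| <= K + (c * x - 1) ^+ 2 / e.
  (* This y gives y / M = z / x, and c is such that c x y = |h|^2 / b^2 is free of x. *)
  move=> x0; pose y := M * z / x.
  have y0 : 0 <= y by apply: divr_ge0 (ltW x0); exact: mulr_ge0 (ltW M0) z0.
  have := askey_scale_dist M (c * x) y e M0 e0 (mulr_ge0 (ltW c0) (ltW x0)) y0.
  have -> : y / M = z / x by rewrite /y; field; rewrite !gt_eqF.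
  have -> : c * x * y = enorm h ^+ 2 / b ^+ 2.
    by rewrite cE /y /z; field; rewrite !gt_eqF.
  by [].
(* Expand (c x - 1)^2 / e: the constant 1/e joins [K], while x and x^2 turn [w0] into [w1] and
   [w2]. *)
have P x : w0 x * `|phi x - g| + 2 * c / e * w1 x <=
    (K + e^-1) * w0 x + c ^+ 2 / e * w2 x.
  rewrite /w2 /w1 -!beta_kernelS ?addr_gt0// -/(w0 x).
  have [x0|x0] := leP x 0.
    by have -> : w0 x = 0 by [rewrite /w0 /beta_kernel kpow_le0// mul0r]; lra.
  rewrite -(lerBrDr _ _ (2 * c / e * (x * w0 x))).
  apply: le_trans (ler_wpM2l (w0_ge0 x) (V x x0)) _.
  by rewrite le_eqVlt; apply/orP; left; apply/eqP; ring.
have k1 : 0 <= 2 * c / e by rewrite divr_ge0 ?mulr_ge0 ?(ltW c0) ?(ltW e0).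
have k2 : 0 <= c ^+ 2 / e by rewrite divr_ge0 ?sqr_ge0 ?(ltW e0).
have k3 : 0 <= K + e^-1 by rewrite addr_ge0 ?invr_ge0 ?(ltW e0).
have k4 : 0 <= g + (K + e^-1) by rewrite addr_ge0.
have mlin (a1 a2 : R) (f1 f2 : R -> R) : measurable_fun setT f1 ->
    measurable_fun setT f2 -> measurable_fun setT (fun x => a1 * f1 x + a2 * f2 x).
  by move=> mf1 mf2; apply: measurable_funD; exact: measurable_funM.
have p0 (x : R) : 0 <= w0 x * phi x by rewrite mulr_ge0.
have le_int (f1 f2 : R -> R) (r1 r2 : R) : measurable_fun setT f1 ->
    measurable_fun setT f2 -> (forall x, 0 <= f1 x) -> (forall x, f1 x <= f2 x) ->
    (\int[mu]_x (f1 x)%:E = r1%:E)%E -> (\int[mu]_x (f2 x)%:E = r2%:E)%E -> r1 <= r2.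
  move=> mf1 mf2 f10 f12 e1 e2; rewrite -lee_fin -e1 -e2.
  by apply: ge0_le_integral => //; [move=> x _; rewrite lee_fin|
    exact/measurable_EFinP|exact/measurable_EFinP|move=> x _; rewrite lee_fin].
(* The cross term of (c x - 1)^2 is moved to the other side, so that only
   nonnegative functions are integrated. *)
have upper : 1 * (G * B) + 2 * c / e * (m1 * B) <=
    (g + (K + e^-1)) * B + c ^+ 2 / e * (m2 * B).
  apply: (le_int (fun x => 1 * (w0 x * phi x) + 2 * c / e * w1 x)
    (fun x => (g + (K + e^-1)) * w0 x + c ^+ 2 / e * w2 x)).
  - exact: mlin.
  - exact: mlin.
  - by move=> x; apply: addr_ge0; apply: mulr_ge0.
  - move=> x; have := P x; have := ler_norm (phi x - g); have := w0_ge0 x; nra.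
  - exact: ge0_integral_lincomb.
  - exact: ge0_integral_lincomb.
(* The factors 1 shape the three-term sum for two nested uses of [ge0_integral_lincomb]. *)
have lower : g * B + 2 * c / e * (m1 * B) <=
    1 * (1 * (G * B) + (K + e^-1) * B) + c ^+ 2 / e * (m2 * B).
  apply: (le_int (fun x => g * w0 x + 2 * c / e * w1 x)
    (fun x => 1 * (1 * (w0 x * phi x) + (K + e^-1) * w0 x) + c ^+ 2 / e * w2 x)).
  - exact: mlin.
  - by apply: (mlin 1) => //; exact: mlin.
  - by move=> x; apply: addr_ge0; apply: mulr_ge0.
  - move=> x; have := P x; have := ler_norm (- (phi x - g)); rewrite normrN.
    by have := w0_ge0 x; nra.
  - exact: ge0_integral_lincomb.
  - apply: ge0_integral_lincomb => //; first exact: mlin.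
      by move=> x; apply: addr_ge0; apply: mulr_ge0.
    exact: ge0_integral_lincomb.
rewrite -(ler_pM2r B0) -(gtr0_norm B0) -normrM (gtr0_norm B0) ler_norml.
have -> : (4 / M + e + (c ^+ 2 * m2 - 2 * c * m1 + 1) / e) * B =
  (K + e^-1) * B + c ^+ 2 / e * (m2 * B) - 2 * c / e * (m1 * B) by rewrite /K; ring.
by apply/andP; split; lra.
Qed.

End GaussianEstimate.

(** * Limits along a filter and the convergence theorem *)

Section Limits.
Context {R : realType} {T : Type} {F : set_system T} {FF : ProperFilter F}.
Implicit Types u v : T -> R.

Lemma cvg_one_subM (k : R) u : u t @[t --> F] --> 0 ->
  1 - k * u t @[t --> F] --> (1 : R).
Proof.
move=> u0; rewrite -[X in _ --> X]subr0 -[in X in _ --> X](mulr0 k).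
by apply: cvgB; [exact: cvg_cst|apply: cvgM => //; exact: cvg_cst].
Qed.

Lemma cvg_divr1 (l : R) u v : u t @[t --> F] --> l -> v t @[t --> F] --> (1 : R) ->
  u t / v t @[t --> F] --> l.
Proof.
move=> ul v1; rewrite -[l]divr1; apply: cvgM => //.
by apply: cvgV => //; exact: oner_neq0.
Qed.

Lemma cvg_inv_pinfty u : u t @[t --> F] --> +oo -> (u t)^-1 @[t --> F] --> (0 : R).
Proof.
move=> uy; apply/gtr0_cvgV0 => //.
exact: (cvgryPgt _).1 uy 0.
Qed.

End Limits.

(** The product condition gives beta - alpha and gamma - alpha the same sign; were both negative, 2
    (beta + gamma) < 4 alpha would contradict the last condition. *)
Lemma param_set_lt (R : realType) d (alpha beta gamma : R) :
  param_set d alpha beta gamma -> [/\ d%:R / 2 < alpha, alpha < beta & alpha < gamma].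
Proof.
move=> [[a0 b0 g0] da h1 h2]; split => //.
  have [//|ba] := ltP alpha beta; nra.
have [//|ga] := ltP alpha gamma; nra.
Qed.

Theorem theorem15 (R : realType) (d : nat) (b : R)
    (T : Type) (F : set_system T) (FF : ProperFilter F)
    (a alpha beta gamma : T -> R) :
  (1 <= d)%N -> 0 < b ->
  a t @[t --> F] --> +oo ->
  alpha t @[t --> F] --> +oo ->
  beta t @[t --> F] --> +oo ->
  gamma t @[t --> F] --> +oo ->
  (\forall t \near F, param_set d (alpha t) (beta t) (gamma t)) ->
  a t * Num.sqrt (alpha t / (beta t * gamma t)) @[t --> F] --> b ->
  {uniform, (fun t => gauss_hyp_cov (d := d) (a t) (alpha t) (beta t) (gamma t)) @ F
            --> gaussian_cov (d := d) b}.
Proof.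
move=> _ b0 ay aly bey gay par Wb.
pose D : R := d%:R / 2.
pose W t := a t * Num.sqrt (alpha t / (beta t * gamma t)).
(* These are (alpha - D)/alpha, (beta - D - 1)/beta and (gamma - D)/gamma, in a form whose limit 1
   is immediate. *)
pose X t := 1 - D * (alpha t)^-1.
pose Y t := 1 - (D + 1) * (beta t)^-1.
pose Z t := 1 - D * (gamma t)^-1.
have al0 : (alpha t)^-1 @[t --> F] --> (0 : R) by exact: cvg_inv_pinfty.
have be0 : (beta t)^-1 @[t --> F] --> (0 : R) by exact: cvg_inv_pinfty.
have ga0 : (gamma t)^-1 @[t --> F] --> (0 : R) by exact: cvg_inv_pinfty.
have X1 : X t @[t --> F] --> (1 : R) by exact: (cvg_one_subM _ _ al0).
have Y1 : Y t @[t --> F] --> (1 : R) by exact: (cvg_one_subM _ _ be0).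
have Z1 : Z t @[t --> F] --> (1 : R) by exact: (cvg_one_subM _ _ ga0).
(* For large parameters [rho] is E [c X] and [sigma] is E [X^2] / E [X]^2 = (1 + 1/A) / (1 +
   1/(gamma - D)), so that [V] below is E [(c X - 1)^2]. *)
pose rho t := W t ^+ 2 / b ^+ 2 * X t / Y t / Z t.
pose sigma t := (1 - -1 * ((alpha t)^-1 / X t)) / (1 - -1 * ((gamma t)^-1 / Z t)).
have rho1 : rho t @[t --> F] --> (1 : R).
  do 2 apply: cvg_divr1 => //.
  rewrite -[X in _ --> X]mul1r; apply: cvgM => //.
  rewrite -(@divff _ (b ^+ 2)) ?expf_neq0 ?gt_eqF//.
  by apply: cvgM; [exact: (cvgM Wb Wb)|exact: cvg_cst].
have sigma1 : sigma t @[t --> F] --> (1 : R).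
  apply: cvg_divr1; apply: cvg_one_subM.
    by apply: (@cvg_divr1 _ _ _ _ 0 (fun t => (alpha t)^-1) X).
  by apply: (@cvg_divr1 _ _ _ _ 0 (fun t => (gamma t)^-1) Z).
pose V t := rho t ^+ 2 * sigma t - 2 * rho t + 1.
have V0 : V t @[t --> F] --> (0 : R).
  have -> : (0 : R) = 1 * 1 * 1 - 2 * 1 + 1 by ring.
  apply: cvgD; last exact: cvg_cst.
  apply: cvgB; first by apply: cvgM => //; exact: cvgM.
  by apply: cvgM => //; exact: cvg_cst.
pose K t := 4 * ((beta t)^-1 / Y t).
have K0 : K t @[t --> F] --> (0 : R).
  rewrite -(mulr0 4); apply: cvgM; first exact: cvg_cst.
  exact: cvg_divr1.
move=> P /uniform_nbhs[E [entE EP]].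
move: entE; rewrite -entourage_ballE => -[eps /= eps0 epsE].
(* The three terms of the estimate are each at most e, and 3 e < eps. *)
pose e := eps / 4; have e0 : 0 < e by rewrite divr_gt0.
apply: (@filterS _ F _ _ _ (fun t => EP _)) => /=.
(* Uniformity: t is fixed before h, and no condition imposed on t involves h. *)
near=> t => h _; apply: epsE.
rewrite /= -ball_normE /ball_/= distrC.
have [da ab ag] : [/\ D < alpha t, alpha t < beta t & alpha t < gamma t].
  by apply: param_set_lt; near: t; exact: par.
have b1 : D + 1 < beta t by near: t; exact: (cvgryPgt _).1 bey _.
have a0 : 0 < a t by near: t; exact: (cvgryPgt _).1 ay _.
have Vt : V t < e * e.
  near: t; exact: (cvgr_lt _ V0 _ (mulr_gt0 e0 e0)).
have Kt : K t < e by near: t; exact: (cvgr_lt _ K0 _ e0).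
have D0 : 0 <= D by rewrite divr_ge0.
have alt : 0 < alpha t by lra.
have bet : 0 < beta t by lra.
have gat : 0 < gamma t by lra.
have XE : X t = (alpha t - D) / alpha t by rewrite /X; field; rewrite gt_eqF.
have YE : Y t = (beta t - D - 1) / beta t by rewrite /Y; field; rewrite gt_eqF.
have ZE : Z t = (gamma t - D) / gamma t by rewrite /Z; field; rewrite gt_eqF.
pose A := alpha t - D; pose q := gamma t - alpha t; pose M := beta t - D - 1.
pose c := a t ^+ 2 / (b ^+ 2 * M).
pose m1 := beta_mean A q; pose m2 := beta_mean (A + 1) q * m1.
have A0 : 0 < A by rewrite subr_gt0.
have M0 : 0 < M by rewrite /M; lra.
have g0 : 0 < gamma t - D by lra.
have g1 : 0 < gamma t - D + 1 by lra.
have Aq : A + q = gamma t - D by rewrite /A /q; ring.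
have W2 : W t ^+ 2 = a t ^+ 2 * (alpha t / (beta t * gamma t)).
  by rewrite /W exprMn sqr_sqrtr// divr_ge0 ?mulr_ge0 ?ltW.
have rhoE : c * m1 = rho t.
  rewrite /rho W2 XE YE ZE /c /m1 /beta_mean Aq -/A -/M.
  by field; rewrite !gt_eqF.
have sigmaE : c ^+ 2 * m2 = rho t ^+ 2 * sigma t.
  rewrite -rhoE /sigma XE ZE /m2 /m1 /beta_mean (addrAC A) Aq -/A.
  by field; rewrite !gt_eqF.
have KE : 4 / M = K t by rewrite /K YE -/M; field; rewrite !gt_eqF.
have bD1 : 1 < beta t - d%:R / 2 by rewrite -/D; lra.
have est := (gauss_hyp_cov_estimate d (a t) b (alpha t) (beta t) (gamma t)
  e A q M c m1 m2 h da ab ag bD1 a0 b0 e0 erefl erefl erefl erefl erefl erefl).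
apply: le_lt_trans est _.
rewrite KE sigmaE -mulrA rhoE -/(V t).
have : V t / e < e by rewrite ltr_pdivrMr.
have : eps = 4 * e by rewrite /e; field.
lra.
Unshelve. all: by end_near. Qed.
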